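(* Let $(\mathbf{d},\mathbf{r})$ be an arithmetical structure on the complete graph $K_n$ with vertices $v_1,\dotsc,v_n$, and write $d_i=d_{v_i}$. Then \[\mathcal{K}(K_n;\mathbf{d},\mathbf{r})\oplus (\mathbb{Z}/\ell\mathbb{Z})^2 \cong \bigoplus_{i=1}^n \mathbb{Z}/(d_i+1)\mathbb{Z},\] where $\ell=\operatorname{lcm}(d_1+1,d_2+1,\dotsc, d_n+1)$.
   Context: An arithmetical structure on a finite, connected, loopless graph $G$ with vertex set $V(G)$ is a pair $(\mathbf{d},\mathbf{r})$, where $\mathbf{r}=(r_v)_{v\in V(G)}$ consists of positive integers with no common factor, $\mathbf{d}=(d_v)_{v\in V(G)}$ consists of nonnegative integers, and for every vertex $v$ we have $r_vd_v=\sum r_u$, the sum being over all $u$ adjacent to $v$ (with multiplicity for multigraphs). Its critical group $\mathcal{K}(G;\mathbf{d},\mathbf{r})$ is the torsion part of the cokernel (over $\mathbb{Z}$) of the matrix $L(G,\mathbf{d})=\operatorname{diag}(\mathbf{d})-A(G)$, where $A(G)$ is the adjacency matrix of $G$. $K_n$ denotes the (simple) complete graph on $n$ vertices. *)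

(* Defs.v *)
From HB Require Import structures.
From mathcomp Require Import all_boot all_order all_algebra.
From mathcomp Require Import boolp.

Set Implicit Arguments.
Unset Strict Implicit.
Unset Printing Implicit Defensive.

Import GRing.Theory.
Local Open Scope ring_scope.

Definition zmod_isog (U V : zmodType) : Prop :=
  exists f : {additive U -> V}, bijective f.

(* Z/mZ for m > 0, using the addition modulo p.+1 that the library puts on
   'I_p.+1.  Unlike 'Z_m, it is the trivial group for m = 1; m = 0 is a junk
   value. *)
Definition Zmod (m : nat) : zmodType := 'I_m.-1.+1.

Section DirectSum.
Variables (I : finType) (M : I -> zmodType).

Definition dsum : Type := {dffun forall i, M i}.
HB.instance Definition _ := Choice.on dsum.

Implicit Types f g h : dsum.
Definition dsum0 : dsum := [ffun i => 0 : M i].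
Definition dsum_opp f : dsum := [ffun i => - f i : M i].
Definition dsum_add f g : dsum := [ffun i => f i + g i : M i].

Fact dsum_addA : associative dsum_add.
Proof. by move=> f g h; apply/ffunP=> i; rewrite !ffunE addrA. Qed.
Fact dsum_addC : commutative dsum_add.
Proof. by move=> f g; apply/ffunP=> i; rewrite !ffunE addrC. Qed.
Fact dsum_add0 : left_id dsum0 dsum_add.
Proof. by move=> f; apply/ffunP=> i; rewrite !ffunE add0r. Qed.
Fact dsum_addN : left_inverse dsum0 dsum_opp dsum_add.
Proof. by move=> f; apply/ffunP=> i; rewrite !ffunE addNr. Qed.
HB.instance Definition _ :=
  GRing.isZmodule.Build dsum dsum_addA dsum_addC dsum_add0 dsum_addN.

End DirectSum.

Section Torsion.
Variable M : zmodType.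

Definition is_torsion : {pred M} :=
  fun x => `[< exists2 k : nat, (0 < k)%N & x *+ k = 0 >].

Fact is_torsion_zmod_closed : zmod_closed is_torsion.
Proof.
split; first by apply/asboolP; exists 1%N.
move=> x y /asboolP[k k0 xk] /asboolP[l l0 yl]; apply/asboolP.
exists (k * l)%N; first by rewrite muln_gt0 k0.
by rewrite mulrnBl mulrnA xk mul0rn mulnC mulrnA yl mul0rn subrr.
Qed.
HB.instance Definition _ :=
  GRing.isZmodClosed.Build M is_torsion is_torsion_zmod_closed.

Record torsion := Torsion {torsion_val : M; _ : torsion_val \in is_torsion}.
HB.instance Definition _ := [isSub for torsion_val].
HB.instance Definition _ := [Choice of torsion by <:].
HB.instance Definition _ := [SubChoice_isSubZmodule of torsion by <:].

End Torsion.

Section Cokernel.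
Variables (m n : nat) (A : 'M[int]_(m, n)).

Definition mx_image : {pred 'cV[int]_m} :=
  fun y => `[< exists x : 'cV[int]_n, y = A *m x >].

Fact mx_image_zmod_closed : zmod_closed mx_image.
Proof.
split; first by apply/asboolP; exists 0; rewrite mulmx0.
move=> _ _ /asboolP[x ->] /asboolP[y ->]; apply/asboolP.
by exists (x - y); rewrite mulmxBr.
Qed.
HB.instance Definition _ :=
  GRing.isZmodClosed.Build 'cV[int]_m mx_image mx_image_zmod_closed.

Definition coker : zmodType := Quotient.quot mx_image.

End Cokernel.

(* Finite connected loopless multigraphs on the vertex set 'I_n; [adj u v] is
   the number of edges between u and v. *)
Record multigraph (n : nat) := Multigraph {
  adj : 'M[nat]_n;
  adj_sym : forall u v, adj u v = adj v u;
  adj_loopless : forall u, adj u u = 0%N;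
  vertices_gt0 : (0 < n)%N;
  adj_connected : forall u v, connect (fun x y => (0 < adj x y)%N) u v
}.

Section CompleteGraph.
Variables (n : nat) (n_gt0 : (0 < n)%N).

Definition complete_adj : 'M[nat]_n := \matrix_(u, v) (u != v : nat).

Fact complete_adj_sym u v : complete_adj u v = complete_adj v u.
Proof. by rewrite !mxE eq_sym. Qed.
Fact complete_adj_loopless u : complete_adj u u = 0%N.
Proof. by rewrite mxE eqxx. Qed.
Fact complete_adj_connected u v :
  connect (fun x y => (0 < complete_adj x y)%N) u v.
Proof.
have [->|uv] := eqVneq u v; first exact: connect0.
by apply: connect1; rewrite mxE uv.
Qed.

Definition complete_graph : multigraph n :=
  Multigraph complete_adj_sym complete_adj_loopless n_gt0
    complete_adj_connected.

End CompleteGraph.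

Record arithmetical_structure (n : nat) (G : multigraph n) :=
  ArithmeticalStructure {
    dvec : 'I_n -> nat;
    rvec : 'I_n -> nat;
    rvec_gt0 : forall v, (0 < rvec v)%N;
    rvec_gcd : \big[gcdn/0%N]_v rvec v = 1%N;
    arithmetical_eq :
      forall v, (rvec v * dvec v = \sum_u adj G v u * rvec u)%N
  }.

Definition laplacian (n : nat) (G : multigraph n) (d : 'I_n -> nat) :
    'M[int]_n :=
  diag_mx (\row_v (d v)%:Z) - map_mx Posz (adj G).

Definition critical_group (n : nat) (G : multigraph n)
    (S : arithmetical_structure G) : zmodType :=
  torsion (coker (laplacian G (dvec S))).

(* Main.v *)
(* Put m_i = d_i + 1 and e = (1, ..., 1).  The structure equations say that
   r_i m_i = \sum_j r_j, and gcd r = 1 forces this common value to be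
   ell = lcm m.  Choose c with \sum_i c_i r_i = 1 and set
   psi z = \sum_i c_i r_i z_i.  The homomorphism
     z |-> ([z - (r.z) c], psi z mod ell, r.z mod ell)
   from Z^n to K + (Z/ell)^2 is onto, and its kernel is the image of diag(m),
   which is also the kernel of z |-> (z_i mod m_i)_i.  The computations rest on
   L (c_i r_i)_i = ell c - e, so that e and ell c agree in the cokernel of L. *)
Require Import Defs.
From HB Require Import structures.
From mathcomp Require Import all_boot all_order all_algebra.
From mathcomp Require Import boolp.
From mathcomp Require Import ring.

Set Implicit Arguments.
Unset Strict Implicit.
Unset Printing Implicit Defensive.

Import GRing.Theory Num.Theory.
Local Open Scope ring_scope.
Local Open Scope quotient_scope.

Lemma zmod_isog_same_kernel (X U V : zmodType)
    (p : {additive X -> U}) (q : {additive X -> V}) :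
    (forall u, exists x, p x = u) -> (forall v, exists x, q x = v) ->
    (forall x, p x = 0 <-> q x = 0) ->
  zmod_isog U V.
Proof.
move=> /choice[s ps] /choice[t qt] kerE.
have pq x y : p x = p y <-> q x = q y.
  have := kerE (x - y); rewrite !raddfB => -[pq qp].
  split=> /eqP; rewrite -subr_eq0 => /eqP.
    by move=> /pq /eqP; rewrite subr_eq0 => /eqP.
  by move=> /qp /eqP; rewrite subr_eq0 => /eqP.
have fB : zmod_morphism (q \o s).
  by move=> u v /=; rewrite -raddfB; apply/pq; rewrite raddfB !ps.
pose f : {additive U -> V} :=
  HB.pack (q \o s) (GRing.isZmodMorphism.Build _ _ (q \o s) fB).
exists f, (p \o t) => [u|v] /=; first by rewrite -[RHS]ps; apply/pq/qt.
by rewrite -[RHS]qt; apply/pq/ps.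
Qed.

Lemma bigBezout (I : finType) (r : I -> nat) :
  exists c : I -> int,
    \sum_i c i * (r i)%:Z = (\big[gcdn/0%N]_i r i)%:Z.
Proof.
apply: (big_ind (fun g => exists c : I -> int,
    \sum_i c i * (r i)%:Z = g%:Z)) => [|g h [c cg] [b bh]|j _].
- by exists (fun=> 0); apply: big1 => i _; rewrite mul0r.
- have [u [v uv]] := Bezoutz g h.
  exists (fun i => u * c i + v * b i).
  rewrite -[RHS]uv -cg -bh !mulr_sumr -big_split /=.
  by apply: eq_bigr => i _; ring.
- exists (fun i => (i == j)%:R); rewrite (bigD1 j) //= eqxx mul1r.
  by rewrite big1 ?addr0 // => i /negPf->; rewrite mul0r.
Qed.

(* ['I_1] has no ring structure, so [z%:~R] is not available here. *)
Definition to_Zmod (m : nat) (z : int) : Zmod m := (Zp1 : 'I_m.-1.+1) *~ z.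

Lemma to_ZmodB m z t : to_Zmod m (z - t) = to_Zmod m z - to_Zmod m t.
Proof. exact: mulrzBr. Qed.

Lemma to_Zmod_eq0 m z : (0 < m)%N -> (to_Zmod m z == 0) = (m%:Z %| z)%Z.
Proof.
case: m => // m _; have natE k : (to_Zmod m.+1 k%:Z == 0) = (m.+1 %| k)%N.
  rewrite /to_Zmod -pmulrn Zp_mulrn -val_eqE /=.
  by rewrite modnMml mul1n.
case: z => k; first by rewrite natE.
by rewrite NegzE /to_Zmod mulrNz oppr_eq0 [LHS]natE dvdzE abszN.
Qed.

Lemma to_Zmod_surj m (x : Zmod m) : to_Zmod m (x : nat)%:Z = x.
Proof.
rewrite /to_Zmod -pmulrn Zp_mulrn; apply: val_inj => /=.
by rewrite modnMml mul1n modn_small.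
Qed.

Section CompleteGraphStructure.
Variables (n : nat) (n_gt0 : (0 < n)%N).
Variable S : arithmetical_structure (complete_graph n_gt0).

Let ell := \big[lcmn/1%N]_(i < n) (dvec S i).+1.

Lemma mul_rvec_dvecS i : (rvec S i * (dvec S i).+1 = \sum_j rvec S j)%N.
Proof.
rewrite mulnS arithmetical_eq [RHS](bigD1 i) //=; congr addn.
rewrite (bigD1 i) //= mxE eqxx mul0n add0n.
by apply: eq_bigr => j ji; rewrite mxE eq_sym ji mul1n.
Qed.

Lemma sum_rvec : (\sum_j rvec S j = ell)%N.
Proof.
apply/eqP; rewrite eqn_dvd andbC; apply/andP; split.
  by apply/dvdn_biglcmP => i _; rewrite -(mul_rvec_dvecS i) dvdn_mull.
have /dvdnP[k kE] : (ell %| \sum_j rvec S j)%N.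
  by apply/dvdn_biglcmP => i _; rewrite -(mul_rvec_dvecS i) dvdn_mull.
have : (k %| \big[gcdn/0%N]_v rvec S v)%N.
  apply/dvdn_biggcdP => i _.
  have /dvdnP[q qE] : ((dvec S i).+1 %| ell)%N by exact: (biglcmn_sup i).
  apply/dvdnP; exists q; apply/eqP.
  rewrite -(@eqn_pmul2r (dvec S i).+1) // mul_rvec_dvecS kE qE.
  by rewrite mulnA [(k * q)%N]mulnC.
by rewrite rvec_gcd dvdn1 => /eqP k1; rewrite kE k1 mul1n.
Qed.

Lemma mul_dvecS_rvec i : (dvec S i).+1%:Z * (rvec S i)%:Z = ell%:Z.
Proof. by rewrite -sum_rvec -(mul_rvec_dvecS i) mulnC PoszM. Qed.

Lemma ell_gt0 : (0 < ell)%N.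
Proof.
by rewrite -sum_rvec -(mul_rvec_dvecS (Ordinal n_gt0)) muln_gt0 rvec_gt0.
Qed.

Let L := laplacian (complete_graph n_gt0) (dvec S).

Lemma mul_laplacian_complete (y : 'cV[int]_n) i :
  (L *m y) i 0 = (dvec S i).+1%:Z * y i 0 - \sum_j y j 0.
Proof.
rewrite mulmxBl mxE mul_diag_mx !mxE (bigD1 i) //= [in RHS](bigD1 i) //=.
under eq_bigr => j ji do rewrite !mxE eq_sym ji mul1r.
by rewrite !mxE eqxx intS mul0r add0r; ring.
Qed.

Definition wsum (w : 'I_n -> int) (z : 'cV[int]_n) := \sum_i w i * z i 0.

Fact wsum_is_zmod_morphism w : zmod_morphism (wsum w).
Proof.
move=> x y; rewrite -sumrB; apply: eq_bigr => i _.
by rewrite !mxE mulrBr.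
Qed.
HB.instance Definition _ w :=
  GRing.isZmodMorphism.Build 'cV[int]_n int (wsum w) (wsum_is_zmod_morphism w).

Lemma wsumZ w a x : wsum w (a *: x) = a * wsum w x.
Proof. by rewrite mulr_sumr; apply: eq_bigr => i _; rewrite mxE mulrCA. Qed.

Let r i := (rvec S i)%:Z.

Lemma wsum_laplacian y : wsum r (L *m y) = 0.
Proof.
transitivity (\sum_i (ell%:Z * y i 0 - r i * \sum_j y j 0)).
  apply: eq_bigr => i _; rewrite mul_laplacian_complete -(mul_dvecS_rvec i) /r.
  by ring.
rewrite sumrB -mulr_sumr -mulr_suml -sum_rvec.
by rewrite (big_morph Posz PoszD (erefl _)) subrr.
Qed.

Lemma laplacian_scale_rvec x :
  wsum r x = 0 -> L *m (\col_i (r i * x i 0)) = ell%:Z *: x.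
Proof.
move=> rx; have sE : \sum_j (\col_k (r k * x k 0)) j 0 = 0.
  by rewrite -[RHS]rx; apply: eq_bigr => j _; rewrite mxE.
apply/colP => i; rewrite mul_laplacian_complete sE subr0 !mxE mulrA.
by rewrite mul_dvecS_rvec.
Qed.

Lemma mx_imageP x :
  reflect (exists y, x = L *m y) (x \in mx_image L).
Proof. exact: asboolP. Qed.

Fact pi_coker_is_zmod_morphism : zmod_morphism (\pi_(coker L)).
Proof. by move=> x y; rewrite pi_addr pi_oppr. Qed.
HB.instance Definition _ :=
  GRing.isZmodMorphism.Build 'cV[int]_n (coker L) (\pi_(coker L))
    pi_coker_is_zmod_morphism.

Lemma pi_coker_eq0 x : (\pi_(coker L) x == 0) = (x \in mx_image L).
Proof. by rewrite -[x in RHS]subr0 Quotient.idealrBE pi_zeror. Qed.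

Lemma pi_coker_torsionP x :
  reflect (wsum r x = 0) (\pi_(coker L) x \in @is_torsion (coker L)).
Proof.
apply: (iffP (asboolP _)) => [[k k_gt0]|rx].
  rewrite -raddfMn => /eqP; rewrite pi_coker_eq0 => /mx_imageP[y xkE].
  have : wsum r x *+ k = 0 :> int.
    by rewrite -[RHS](wsum_laplacian y) -xkE; exact/esym/(raddfMn (wsum r)).
  by move/eqP; rewrite mulrn_eq0 eqn0Ngt k_gt0 => /eqP.
exists ell; first exact: ell_gt0.
apply/eqP; rewrite -raddfMn pi_coker_eq0; apply/mx_imageP.
exists (\col_i (r i * x i 0)).
by rewrite laplacian_scale_rvec // -scaler_nat natz.
Qed.

Variable c : 'I_n -> int.
Hypothesis c_r1 : \sum_i c i * r i = 1.

Let ccol := \col_i c i.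
Let psi : 'cV[int]_n -> int := wsum (fun i => c i * r i).
Let proj (z : 'cV[int]_n) : 'cV[int]_n := z - wsum r z *: ccol.

Lemma wsum_ccol : wsum r ccol = 1.
Proof. by rewrite -c_r1; apply: eq_bigr => i _; rewrite mxE mulrC. Qed.

Lemma wsum_const k : wsum r (const_mx k) = ell%:Z * k.
Proof.
rewrite -sum_rvec (big_morph Posz PoszD (erefl _)) mulr_suml.
by apply: eq_bigr => i _; rewrite mxE.
Qed.

Lemma psi_const k : psi (const_mx k) = k.
Proof.
rewrite -[RHS]mul1r -c_r1 mulr_suml.
by apply: eq_bigr => i _; rewrite mxE.
Qed.

Lemma wsum_proj z : wsum r (proj z) = 0.
Proof. by rewrite raddfB /= wsumZ wsum_ccol mulr1 subrr. Qed.

Lemma dvd_dvecS_ell i : ((dvec S i).+1%:Z %| ell%:Z)%Z.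
Proof. by rewrite -(mul_dvecS_rvec i) dvdz_mulr. Qed.

Lemma laplacian_col_c_r k :
  L *m (\col_i (c i * r i * k)) = k *: (ell%:Z *: ccol - const_mx 1).
Proof.
apply/colP => i; rewrite mul_laplacian_complete !mxE.
have -> : \sum_j (\col_i (c i * r i * k)) j 0 = k.
  rewrite -[RHS]mul1r -c_r1 mulr_suml.
  by apply: eq_bigr => j _; rewrite mxE.
by rewrite -(mul_dvecS_rvec i) /r; ring.
Qed.

Lemma dvdz_coordsP (z : 'cV[int]_n) :
  (forall i, (dvec S i).+1%:Z %| z i 0%R)%Z <->
  [/\ proj z \in mx_image L, (ell%:Z %| psi z)%Z & (ell%:Z %| wsum r z)%Z].
Proof.
split=> [mz | [/mx_imageP[y zy] /dvdzP[q qE] /dvdzP[s sE]] i].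
  pose y := \col_i (z i 0%R %/ (dvec S i).+1%:Z)%Z.
  have zE i : z i 0 = (dvec S i).+1%:Z * y i 0.
    by rewrite mxE mulrC divzK.
  clearbody y.
  have rzE : wsum r z = ell%:Z * \sum_i y i 0.
    rewrite mulr_sumr; apply: eq_bigr => i _.
    by rewrite zE -(mul_dvecS_rvec i) /r; ring.
  split; last by rewrite rzE dvdz_mulr.
    apply/mx_imageP.
    exists (y - \col_i (c i * r i * \sum_j y j 0)).
    rewrite mulmxBr laplacian_col_c_r; apply/colP => i.
    rewrite [RHS]mxE mul_laplacian_complete /proj rzE !mxE zE.
    by ring.
  apply/dvdzP; exists (\sum_i c i * y i 0).
  rewrite mulr_suml; apply: eq_bigr => i _.
  by rewrite zE -(mul_dvecS_rvec i) /r; ring.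
have zE j : z j 0 =
    (dvec S j).+1%:Z * y j 0 - \sum_k y k 0 + s * ell%:Z * c j.
  by rewrite -mul_laplacian_complete -zy /proj sE !mxE; ring.
have : psi z = (\sum_j (c j * y j 0 + s * c j * r j * c j)) * ell%:Z
               - \sum_k y k 0.
  rewrite -[\sum_k y k 0]mul1r -c_r1 2!mulr_suml -sumrB.
  apply: eq_bigr => j _.
  by rewrite zE -(mul_dvecS_rvec j) /r; ring.
set sigma := \sum_k y k 0 in zE *; rewrite qE => sigmaE.
have ell_sigma : (ell%:Z %| sigma)%Z.
  apply/dvdzP; exists (\sum_j (c j * y j 0 + s * c j * r j * c j) - q).
  by rewrite mulrBl sigmaE; ring.
rewrite zE rpredD ?rpredB //=.
- exact: dvdz_mulr.
- exact: dvdz_trans (dvd_dvecS_ell i) ell_sigma.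
- by rewrite -mulrA mulrC -mulrA dvdz_mulr ?dvd_dvecS_ell.
Qed.

Definition residues (z : 'cV[int]_n) : dsum (fun i => Zmod (dvec S i).+1) :=
  [ffun i => to_Zmod (dvec S i).+1 (z i 0)].

Fact residues_is_zmod_morphism : zmod_morphism residues.
Proof. by move=> x y; apply/ffunP => i; rewrite !ffunE !mxE to_ZmodB. Qed.
HB.instance Definition _ :=
  GRing.isZmodMorphism.Build 'cV[int]_n _ residues residues_is_zmod_morphism.

Lemma residues_surj g : exists z, residues z = g.
Proof.
exists (\col_i (g i : nat)%:Z); apply/ffunP => i.
by rewrite ffunE mxE to_Zmod_surj.
Qed.

Lemma residues_eq0 (z : 'cV[int]_n) :
  residues z = 0 <-> (forall i, (dvec S i).+1%:Z %| z i 0%R)%Z.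
Proof.
split=> [z0 i | mz]; last first.
  by apply/ffunP => i; rewrite !ffunE; apply/eqP; rewrite to_Zmod_eq0.
by rewrite -to_Zmod_eq0 //; have /ffunP/(_ i) := z0; rewrite !ffunE => ->.
Qed.

Definition critical_coords (z : 'cV[int]_n) :
    (critical_group S * (Zmod ell * Zmod ell))%type :=
  (Torsion (introT (pi_coker_torsionP _) (wsum_proj z)),
   (to_Zmod ell (psi z), to_Zmod ell (wsum r z))).

Fact critical_coords_is_zmod_morphism : zmod_morphism critical_coords.
Proof.
move=> x y; congr (_, (_, _)).
- apply: val_inj => /=; rewrite -raddfB /=; congr (\pi_(coker L) _).
  by apply/colP => i; rewrite /proj raddfB !mxE; ring.
- by rewrite -to_ZmodB -raddfB.
- by rewrite -to_ZmodB -raddfB.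
Qed.
HB.instance Definition _ :=
  GRing.isZmodMorphism.Build 'cV[int]_n _ critical_coords
    critical_coords_is_zmod_morphism.

Lemma critical_coords_eq0 z :
  critical_coords z = 0 <->
  [/\ proj z \in mx_image L, (ell%:Z %| psi z)%Z & (ell%:Z %| wsum r z)%Z].
Proof.
rewrite -pi_coker_eq0 -!to_Zmod_eq0 ?ell_gt0 //.
split=> [[-> -> ->] // | [/eqP z0 /eqP a0 /eqP b0]].
by congr (_, (_, _)) => //; apply: val_inj.
Qed.

Lemma critical_coords_surj u : exists z, critical_coords z = u.
Proof.
case: u => -[t tors] [a b].
have tE : \pi_(coker L) (repr t) = t by exact: reprK.
have r0 : wsum r (repr t) = 0 by apply/pi_coker_torsionP; rewrite tE.
pose b' := (b : nat)%:Z.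
(* A [pose] would let [raddfD] see the sum inside [k] and split it. *)
have [k kE] : exists k, k = (a : nat)%:Z - psi (repr t) - b' * psi ccol.
  by eexists.
exists (repr t + b' *: ccol + const_mx k).
have rzE : wsum r (repr t + b' *: ccol + const_mx k) = b' + ell%:Z * k.
  by rewrite !raddfD /= wsumZ r0 wsum_const wsum_ccol mulr1 add0r.
congr (_, (_, _)).
- apply: val_inj => /=; rewrite -[RHS]tE.
  apply/eqP; rewrite -subr_eq0 -raddfB pi_coker_eq0; apply/mx_imageP.
  exists (\col_i (c i * r i * - k)); rewrite laplacian_col_c_r.
  by apply/colP => i; rewrite /proj rzE !mxE; ring.
- rewrite -[RHS]to_Zmod_surj; congr to_Zmod.
  by rewrite /psi !raddfD /= wsumZ -/psi psi_const kE; ring.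
- rewrite -[RHS]to_Zmod_surj rzE -[ell%:Z * k]opprK to_ZmodB.
  have /eqP-> : to_Zmod ell (- (ell%:Z * k)) == 0.
    by rewrite to_Zmod_eq0 ?ell_gt0 // -mulrN dvdz_mulr.
  by rewrite subr0.
Qed.

End CompleteGraphStructure.

Local Close Scope quotient_scope.
Local Close Scope ring_scope.

Theorem corollary8 (n : nat) (n_gt0 : (0 < n)%N)
    (S : arithmetical_structure (complete_graph n_gt0)) :
  let ell := \big[lcmn/1%N]_(i < n) (dvec S i).+1 in
  zmod_isog (critical_group S * (Zmod ell * Zmod ell))%type
            (dsum (fun i : 'I_n => Zmod (dvec S i).+1)).
Proof.
move=> ell; have [c c_r1] := bigBezout (rvec S).
rewrite rvec_gcd in c_r1.
apply: (@zmod_isog_same_kernel 'cV[int]_n _ _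
  (critical_coords c_r1) (@residues n n_gt0 S)) => [u | g | z].
- exact: critical_coords_surj.
- exact: residues_surj.
- apply: iff_trans (critical_coords_eq0 c_r1 z) _; apply: iff_sym.
  exact: iff_trans (residues_eq0 S z) (dvdz_coordsP c_r1 z).
Qed.
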